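(* Let $T:V\to\mathfrak{L}$ be a relative Rota-Baxter operator on a Leibniz triple system $(\mathfrak{L},\{\cdot,\cdot,\cdot\})$ with respect to a representation $(r,m,l)$ of $\mathfrak{L}$ on $V$. If two formal deformations $T_t'=\sum_{i\ge0}\mathfrak{T}_i't^i$ and $T_t=\sum_{i\ge0}\mathfrak{T}_it^i$ of $T$ are equivalent, then their infinitesimals $\mathfrak{T}_1'$ and $\mathfrak{T}_1$ are in the same cohomology class, i.e. they are $1$-cocycles whose difference lies in the linear span of the $1$-cocycles $\delta(a,b)$, $a,b\in\mathfrak{L}$.
   Context: All vector spaces are over a fixed arbitrary field $\mathbb{F}$. A Leibniz triple system is a vector space $\mathfrak{L}$ with a trilinear operation $\{\cdot,\cdot,\cdot\}:\mathfrak{L}\times\mathfrak{L}\times\mathfrak{L}\to\mathfrak{L}$ such that for all $a,b,c,d,e\in\mathfrak{L}$: $\{a,b,\{c,d,e\}\}=\{\{a,b,c\},d,e\}-\{\{a,b,d\},c,e\}-\{\{a,b,e\},c,d\}+\{\{a,b,e\},d,c\}$ and $\{a,\{b,c,d\},e\}=\{\{a,b,c\},d,e\}-\{\{a,c,b\},d,e\}-\{\{a,d,b\},c,e\}+\{\{a,d,c\},b,e\}$. A representation of $\mathfrak{L}$ on a vector space $V$ is a triple $(r,m,l)$ of bilinear maps $l,m,r:\mathfrak{L}\times\mathfrak{L}\to\mathrm{End}(V)$ such that for all $a,b,c,d\in\mathfrak{L}$: $l(a,\{b,c,d\})=l(\{a,b,c\},d)-l(\{a,c,b\},d)-l(\{a,d,b\},c)+l(\{a,d,c\},b)$;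 $m(a,d)l(b,c)=m(\{a,b,c\},d)-m(\{a,c,b\},d)-r(c,d)m(a,b)+r(b,d)m(a,c)$; $m(a,d)m(b,c)=r(c,d)l(a,b)-r(c,d)m(a,b)-m(\{a,c,b\},d)+r(b,d)l(a,c)$; $m(a,d)r(b,c)=r(c,d)m(a,b)-r(c,d)l(a,b)-r(b,d)l(a,c)+m(\{a,c,b\},d)$; $r(\{a,b,c\},d)=r(c,d)r(a,b)-r(c,d)r(b,a)-r(b,d)r(c,a)+r(a,d)r(c,b)$; $l(a,b)l(c,d)=l(\{a,b,c\},d)-l(\{a,b,d\},c)-r(c,d)l(a,b)+r(d,c)l(a,b)$; $l(a,b)m(c,d)=m(\{a,b,c\},d)-r(c,d)l(a,b)-l(\{a,b,d\},c)+m(\{a,b,d\},c)$; $l(a,b)r(c,d)=r(c,d)l(a,b)-m(\{a,b,c\},d)-m(\{a,b,d\},c)+l(\{a,b,d\},c)$; $m(a,\{b,c,d\})=r(c,d)m(a,b)-r(b,d)m(a,c)-r(b,c)m(a,d)+r(c,b)m(a,d)$; $r(a,\{b,c,d\})=r(c,d)r(a,b)-r(b,d)r(a,c)-r(b,c)r(a,d)+r(c,b)r(a,d)$. A relative Rota-Baxter operator on $(\mathfrak{L},\{\cdot,\cdot,\cdot\})$ with respect to $(r,m,l)$ is a linear map $T:V\to\mathfrak{L}$ with $\{Tu,Tv,Tw\}=T\big(l(Tu,Tv)w+m(Tu,Tw)v+r(Tv,Tw)u\big)$ for all $u,v,w\in V$. Cocycles: a linear map $f:V\to\mathfrak{L}$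 is a $1$-cocycle for $T$ if $\partial^1f=0$, where $\partial^1f(v_1,v_2,v_3)=\{f(v_1),Tv_2,Tv_3\}-T\big(l(f(v_1),Tv_2)v_3+m(f(v_1),Tv_3)v_2\big)+\{Tv_1,f(v_2),Tv_3\}-T\big(l(Tv_1,f(v_2))v_3+r(f(v_2),Tv_3)v_1\big)+\{Tv_1,Tv_2,f(v_3)\}-T\big(m(Tv_1,f(v_3))v_2+r(Tv_2,f(v_3))v_1\big)-f\big(l(Tv_1,Tv_2)v_3+m(Tv_1,Tv_3)v_2+r(Tv_2,Tv_3)v_1\big)$. For $a,b\in\mathfrak{L}$ put $R_{(a,b)}x=\{x,a,b\}$ for $x\in\mathfrak{L}$, and define $\delta(a,b):V\to\mathfrak{L}$ by $\delta(a,b)v=Tr(a,b)v-Tr(b,a)v-R_{(a,b)}Tv+R_{(b,a)}Tv$; these maps are $1$-cocycles. Two $1$-cocycles are in the same cohomology class if their difference lies in the linear span of the maps $\delta(a,b)$. The ternary product of $\mathfrak{L}$ and the maps $l,m,r$ are extended $t$-adically and $\mathbb{F}[[t]]$-multilinearly to $\mathfrak{L}[[t]]$ and $V[[t]]$ (e.g. $\{\sum x_it^i,\sum y_jt^j,\sum z_kt^k\}=\sum_s\sum_{i+j+k=s}\{x_i,y_j,z_k\}t^s$, and similarly for $l,m,r$). A formal deformation of $T$ is a power series $T_t=\sum_{i\ge0}\mathfrak{T}_it^i$ with $\mathfrak{T}_i\in\mathrm{Hom}_{\mathbb{F}}(V,\mathfrak{L})$, $\mathfrak{T}_0=T$, extended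 to an $\mathbb{F}[[t]]$-module map $V[[t]]\to\mathfrak{L}[[t]]$, such that $\{T_t(u),T_t(v),T_t(w)\}=T_t\big(l(T_t(u),T_t(v))w+m(T_t(u),T_t(w))v+r(T_t(v),T_t(w))u\big)$ for all $u,v,w\in V$. The infinitesimal of $T_t$ is the $1$-cocycle $\mathfrak{T}_1$. Two formal deformations $T_t'=\sum_{i\ge0}\mathfrak{T}_i't^i$ and $T_t=\sum_{i\ge0}\mathfrak{T}_it^i$ of $T=\mathfrak{T}_0'=\mathfrak{T}_0$ are equivalent if there exist $x,y\in\mathfrak{L}$, $\phi_i\in\mathrm{End}(\mathfrak{L})$ and $\psi_i\in\mathrm{End}(V)$ ($i\ge2$) such that for $\phi_t=\mathrm{id}_{\mathfrak{L}}+t(R_{(x,y)}-R_{(y,x)})+\sum_{i\ge2}\phi_it^i$ and $\psi_t=\mathrm{id}_V+t(r(x,y)-r(y,x))+\sum_{i\ge2}\psi_it^i$ one has: (1) $\{\phi_t(a),\phi_t(b),\phi_t(c)\}=\phi_t\{a,b,c\}$ for all $a,b,c\in\mathfrak{L}$; (2) $\psi_t\,l(a,b)u=l(\phi_t(a),\phi_t(b))\psi_t(u)$, $\psi_t\,m(a,b)u=m(\phi_t(a),\phi_t(b))\psi_t(u)$, $\psi_t\,r(a,b)u=r(\phi_t(a),\phi_t(b))\psi_t(u)$ for all $a,b\in\mathfrak{L}$, $u\in V$; (3) $T_t\circ\psi_t=\phi_t\circ T_t'$ as $\mathbb{F}[[t]]$-module maps. *)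

(* Defs.v *)
From HB Require Import structures.
From mathcomp Require Import all_boot all_order all_algebra.

Set Implicit Arguments.
Unset Strict Implicit.
Unset Printing Implicit Defensive.

Import GRing.Theory.
Local Open Scope ring_scope.

Section LeibnizTripleSystem.
Variables (F : fieldType) (L : lmodType F).

Definition trilinear (br : L -> L -> L -> L) : Prop :=
  [/\ forall b c, linear (fun a => br a b c),
      forall a c, linear (fun b => br a b c)
    & forall a b, linear (fun c => br a b c)].

Record is_leibniz_triple_system (br : L -> L -> L -> L) : Prop :=
  IsLeibnizTripleSystem {
    lts_trilinear : trilinear br;
    lts_right : forall a b c d e,
      br a b (br c d e) =
      br (br a b c) d e - br (br a b d) c e - br (br a b e) c d
      + br (br a b e) d c;
    lts_middle : forall a b c d e,
      br a (br b c d) e =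
      br (br a b c) d e - br (br a c b) d e - br (br a d b) c e
      + br (br a d c) b e }.

End LeibnizTripleSystem.

Section Representation.
Variables (F : fieldType) (L V : lmodType F) (br : L -> L -> L -> L).

(* Linear maps are compared pointwise throughout, and a product such as
   m(a,d)l(b,c) in End(V) is the composite u |-> m(a,d)(l(b,c)u). *)
Definition bilinear_to_End (g : L -> L -> {linear V -> V}) : Prop :=
  (forall b u, linear (fun a => g a b u)) /\
  (forall a u, linear (fun b => g a b u)).

Record is_representation (r m l : L -> L -> {linear V -> V}) : Prop :=
  IsRepresentation {
    rep_r_bilinear : bilinear_to_End r;
    rep_m_bilinear : bilinear_to_End m;
    rep_l_bilinear : bilinear_to_End l;
    rep_l_br : forall a b c d u,
      l a (br b c d) u =
      l (br a b c) d u - l (br a c b) d u - l (br a d b) c u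
      + l (br a d c) b u;
    rep_m_l : forall a b c d u,
      m a d (l b c u) =
      m (br a b c) d u - m (br a c b) d u - r c d (m a b u)
      + r b d (m a c u);
    rep_m_m : forall a b c d u,
      m a d (m b c u) =
      r c d (l a b u) - r c d (m a b u) - m (br a c b) d u
      + r b d (l a c u);
    rep_m_r : forall a b c d u,
      m a d (r b c u) =
      r c d (m a b u) - r c d (l a b u) - r b d (l a c u)
      + m (br a c b) d u;
    rep_r_br : forall a b c d u,
      r (br a b c) d u =
      r c d (r a b u) - r c d (r b a u) - r b d (r c a u)
      + r a d (r c b u);
    rep_l_l : forall a b c d u,
      l a b (l c d u) =
      l (br a b c) d u - l (br a b d) c u - r c d (l a b u)
      + r d c (l a b u);
    rep_l_m : forall a b c d u,
      l a b (m c d u) =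
      m (br a b c) d u - r c d (l a b u) - l (br a b d) c u
      + m (br a b d) c u;
    rep_l_r : forall a b c d u,
      l a b (r c d u) =
      r c d (l a b u) - m (br a b c) d u - m (br a b d) c u
      + l (br a b d) c u;
    rep_m_br : forall a b c d u,
      m a (br b c d) u =
      r c d (m a b u) - r b d (m a c u) - r b c (m a d u)
      + r c b (m a d u);
    rep_r_br_right : forall a b c d u,
      r a (br b c d) u =
      r c d (r a b u) - r b d (r a c u) - r b c (r a d u)
      + r c b (r a d u) }.

End Representation.

Section Cohomology.
Variables (F : fieldType) (L V : lmodType F) (br : L -> L -> L -> L).
Variables (r m l : L -> L -> {linear V -> V}).

Definition is_relative_rota_baxter (T : {linear V -> L}) : Prop :=
  forall u v w,
    br (T u) (T v) (T w) =
    T (l (T u) (T v) w + m (T u) (T w) v + r (T v) (T w) u).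

Definition partial1 (T f : {linear V -> L}) (v1 v2 v3 : V) : L :=
  br (f v1) (T v2) (T v3)
  - T (l (f v1) (T v2) v3 + m (f v1) (T v3) v2)
  + br (T v1) (f v2) (T v3)
  - T (l (T v1) (f v2) v3 + r (f v2) (T v3) v1)
  + br (T v1) (T v2) (f v3)
  - T (m (T v1) (f v3) v2 + r (T v2) (f v3) v1)
  - f (l (T v1) (T v2) v3 + m (T v1) (T v3) v2 + r (T v2) (T v3) v1).

Definition is_1cocycle (T f : {linear V -> L}) : Prop :=
  forall v1 v2 v3, partial1 T f v1 v2 v3 = 0.

Definition Rmul (a b x : L) : L := br x a b.

Definition delta (T : {linear V -> L}) (a b : L) (v : V) : L :=
  T (r a b v) - T (r b a v) - Rmul a b (T v) + Rmul b a (T v).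

Definition in_span_delta (T : {linear V -> L}) (f : V -> L) : Prop :=
  exists (n : nat) (c : 'I_n -> F) (a b : 'I_n -> L),
    forall v, f v = \sum_(i < n) c i *: delta T (a i) (b i) v.

Definition same_cohomology_class (T f g : {linear V -> L}) : Prop :=
  [/\ is_1cocycle T f, is_1cocycle T g
    & in_span_delta T (fun v => f v - g v)].

End Cohomology.

Section FormalPowerSeries.

(* A[[t]] : the series sum_n (x n) t^n is the sequence x of its coefficients,
   and series are compared coefficientwise. *)
Definition fps (A : Type) : Type := nat -> A.

Definition fps_const (A : nmodType) (a : A) : fps A :=
  fun n => if n is 0 then a else 0.

Definition fps_add (A : nmodType) (x y : fps A) : fps A :=
  fun n => x n + y n.

(* The map A[[t]] -> B[[t]] induced by sum_i (f i) t^i. *)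
Definition fps_map (A : Type) (B : nmodType) (f : nat -> A -> B)
    (x : fps A) : fps B :=
  fun n => \sum_(i < n.+1) f i (x (n - i)%N).

(* The t-adic extension of a trilinear map: the coefficient of t^n sums over
   all i + j + k = n, with k = n - i - j. *)
Definition fps_ext3 (A B C : Type) (D : nmodType) (g : A -> B -> C -> D)
    (x : fps A) (y : fps B) (z : fps C) : fps D :=
  fun n => \sum_(i < n.+1) \sum_(j < (n - i).+1)
             g (x i) (y j) (z (n - i - j)%N).

End FormalPowerSeries.

Section Deformation.
Variables (F : fieldType) (L V : lmodType F) (br : L -> L -> L -> L).
Variables (r m l : L -> L -> {linear V -> V}).

Let ext_br := fps_ext3 br.
Let ext_l := fps_ext3 (fun a b u => l a b u).
Let ext_m := fps_ext3 (fun a b u => m a b u).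
Let ext_r := fps_ext3 (fun a b u => r a b u).

Definition is_formal_deformation (T : {linear V -> L})
    (Ti : nat -> {linear V -> L}) : Prop :=
  let Tt := fps_map (fun i v => Ti i v) in
  (forall v, Ti 0%N v = T v) /\
  forall u0 v0 w0 : V,
    let u := fps_const u0 in
    let v := fps_const v0 in
    let w := fps_const w0 in
    ext_br (Tt u) (Tt v) (Tt w) =1
    Tt (fps_add (fps_add (ext_l (Tt u) (Tt v) w) (ext_m (Tt u) (Tt w) v))
                (ext_r (Tt v) (Tt w) u)).

(* Only the values of phi and psi at indices i >= 2 are used. *)
Definition equiv_phi (x y : L) (phi : nat -> {linear L -> L}) (i : nat) (a : L)
    : L :=
  match i with
  | 0 => a
  | 1 => Rmul br x y a - Rmul br y x a
  | _ => phi i a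
  end.

Definition equiv_psi (x y : L) (psi : nat -> {linear V -> V}) (i : nat) (u : V)
    : V :=
  match i with
  | 0 => u
  | 1 => r x y u - r y x u
  | _ => psi i u
  end.

Definition equivalent_deformations (Ti' Ti : nat -> {linear V -> L}) : Prop :=
  exists (x y : L) (phi : nat -> {linear L -> L})
         (psi : nat -> {linear V -> V}),
  let phit := fps_map (equiv_phi x y phi) in
  let psit := fps_map (equiv_psi x y psi) in
  let Tt' := fps_map (fun i v => Ti' i v) in
  let Tt := fps_map (fun i v => Ti i v) in
  [/\ forall a b c : L,
        ext_br (phit (fps_const a)) (phit (fps_const b)) (phit (fps_const c))
        =1 phit (fps_const (br a b c)),
      forall (a b : L) (u : V),
        [/\ psit (fps_const (l a b u)) =1
              ext_l (phit (fps_const a)) (phit (fps_const b))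
                    (psit (fps_const u)),
            psit (fps_const (m a b u)) =1
              ext_m (phit (fps_const a)) (phit (fps_const b))
                    (psit (fps_const u))
          & psit (fps_const (r a b u)) =1
              ext_r (phit (fps_const a)) (phit (fps_const b))
                    (psit (fps_const u))]
    & forall u : fps V, Tt (psit u) =1 phit (Tt' u)].

End Deformation.

(* Main.v *)
Require Import Defs.
From mathcomp Require Import all_boot all_order all_algebra.

(** Everything happens modulo t^2.  The Rota-Baxter identity for a formal
    deformation, read at t^1, is the linearization of the identity for T in
    the direction of the infinitesimal, that is, the 1-cocycle equation.  The
    intertwining relation T_t psi_t = phi_t T'_t, read at t^1 on a constant
    series v, says
      T_1 v + T (r(x,y) v - r(y,x) v)
        = T'_1 v + R_(x,y) (T v) - R_(y,x) (T v),
    so T'_1 - T_1 is the single coboundary delta(x,y).  The two facts are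
    [infinitesimal_is_1cocycle] and [equivalent_infinitesimals_differ_by_delta];
    both rest on formulas for the coefficients of index 0 and 1 of the t-adic
    extensions. *)

Set Implicit Arguments.
Unset Strict Implicit.
Unset Printing Implicit Defensive.

Import GRing.Theory.
Local Open Scope ring_scope.

Lemma fps_map_coef0 (A : Type) (B : nmodType) (f : nat -> A -> B) (x : fps A) :
  fps_map f x 0 = f 0%N (x 0%N).
Proof. by rewrite /fps_map big_ord1. Qed.

Lemma fps_map_coef1 (A : Type) (B : nmodType) (f : nat -> A -> B) (x : fps A) :
  fps_map f x 1 = f 0%N (x 1%N) + f 1%N (x 0%N).
Proof. by rewrite /fps_map !big_ord_recl big_ord0 addr0. Qed.

Lemma fps_ext3_coef0 (A B C : Type) (D : nmodType) (g : A -> B -> C -> D)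
    (x : fps A) (y : fps B) (z : fps C) :
  fps_ext3 g x y z 0 = g (x 0%N) (y 0%N) (z 0%N).
Proof. by rewrite /fps_ext3 !big_ord1. Qed.

Lemma fps_ext3_coef1 (A B C : Type) (D : nmodType) (g : A -> B -> C -> D)
    (x : fps A) (y : fps B) (z : fps C) :
  fps_ext3 g x y z 1 =
    g (x 1%N) (y 0%N) (z 0%N) + g (x 0%N) (y 1%N) (z 0%N)
    + g (x 0%N) (y 0%N) (z 1%N).
Proof.
rewrite /fps_ext3 !big_ord_recl !big_ord0 /= !addr0.
by rewrite (ACl (3*2*1)).
Qed.

Section FirstOrder.
Variables (F : fieldType) (L V : lmodType F) (br : L -> L -> L -> L).
Variables (r m l : L -> L -> {linear V -> V}).

(** The coefficient of t^1 in the Rota-Baxter identity for the deformation.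
    As u, v, w are constant series, each of l, m, r contributes only the two
    terms in which the infinitesimal replaces T in one algebra slot; these six
    terms, the three from the bracket and the infinitesimal applied to the
    order-zero expression make up the coboundary operator. *)
Lemma infinitesimal_is_1cocycle (T : {linear V -> L})
    (Ti : nat -> {linear V -> L}) :
  is_formal_deformation br r m l T Ti -> is_1cocycle br r m l T (Ti 1%N).
Proof.
move=> [T0 RB] v1 v2 v3; have /= := RB v1 v2 v3 1%N.
rewrite !(fps_ext3_coef1, fps_map_coef1, fps_map_coef0) /fps_add.
rewrite !(fps_ext3_coef1, fps_ext3_coef0, fps_map_coef1, fps_map_coef0) /=.
(* The terms equal to 0 come from the coefficients of positive index of
   constant series, always in the slot where the maps are linear. *)
rewrite !raddf0 !add0r !addr0 !T0 /partial1 => RB1.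
(* Gather the bracket terms, so that RB1 replaces them by T (...) + Ti 1 (...);
   the subtracted terms are then a regrouping of the same sum. *)
rewrite -!addrA -!opprD.
set b1 := br (Ti 1%N v1) _ _ in RB1 *.
set b2 := br _ (Ti 1%N v2) _ in RB1 *.
set b3 := br _ _ (Ti 1%N v3) in RB1 *.
suff reorder (A B C D : L) :
    b1 + (- A + (b2 + (- B + (b3 - (C + D))))) = b1 + b2 + b3 - (A + B + C + D).
  rewrite reorder RB1 -!raddfD /=.
  apply/eqP; rewrite subr_eq0; apply/eqP; congr (T _ + Ti 1%N _).
    by rewrite !addrA [LHS](ACl (1*3*2*5*4*6)).
  by rewrite !addrA.
by rewrite !opprD !addrA [LHS](ACl (1*3*5*2*4*6*7)).
Qed.

(** The pair (x, y) is the one defining the linear terms of phi_t and psi_t: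
    modulo t^2 an equivalence is determined by it. *)
Lemma equivalent_infinitesimals_differ_by_delta (T : {linear V -> L})
    (Ti' Ti : nat -> {linear V -> L}) :
  (forall v, Ti' 0%N v = T v) -> (forall v, Ti 0%N v = T v) ->
  equivalent_deformations br r m l Ti' Ti ->
  exists x y : L, forall v, Ti' 1%N v - Ti 1%N v = delta br r T x y v.
Proof.
move=> T0' T0 [x [y [phi [psi [_ _ intertw]]]]]; exists x, y => v.
have := intertw (fps_const v) 1%N.
rewrite !(fps_map_coef1, fps_map_coef0) /= raddf0 !add0r T0 T0' raddfB /delta.
move=> /esym/(canRL (addrK _)) ->.
by rewrite addrAC addrK opprD opprK addrA.
Qed.

End FirstOrder.

Local Close Scope ring_scope.

Theorem theorem5p10 (F : fieldType) (L V : lmodType F)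
    (br : L -> L -> L -> L) (hL : is_leibniz_triple_system br)
    (r m l : L -> L -> {linear V -> V}) (hV : is_representation br r m l)
    (T : {linear V -> L}) (hT : is_relative_rota_baxter br r m l T)
    (Ti' Ti : nat -> {linear V -> L})
    (hTi' : is_formal_deformation br r m l T Ti')
    (hTi : is_formal_deformation br r m l T Ti)
    (hequiv : equivalent_deformations br r m l Ti' Ti) :
  same_cohomology_class br r m l T (Ti' 1) (Ti 1).
Proof.
split; try exact: infinitesimal_is_1cocycle.
have [x [y dT]] :=
  equivalent_infinitesimals_differ_by_delta hTi'.1 hTi.1 hequiv.
exists 1, (fun=> 1%R), (fun=> x), (fun=> y) => v.
by rewrite big_ord1 scale1r dT.
Qed.
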